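(* Let $(A,\cdot_A,a_A)$ be a left-symmetric algebroid over a manifold $M$. Define a skew-symmetric bilinear bracket on $\Gamma(A)$ by $$[x,y]_A = x\cdot_A y - y\cdot_A x,\qquad \forall x,y\in\Gamma(A).$$ Then $(A,[\cdot,\cdot]_A,a_A)$ is a Lie algebroid. Furthermore, the map $L:A\to\mathfrak{D}(A)$, $x\mapsto L_x$, where $L_x(y)=x\cdot_A y$ for $y\in\Gamma(A)$, is a representation of the Lie algebroid $(A,[\cdot,\cdot]_A,a_A)$ on the vector bundle $A$.
   Context: All vector bundles are over the same smooth manifold $M$; bundle maps cover the identity of $M$ and are $C^\infty(M)$-linear on sections. A left-symmetric algebra is a vector space with a bilinear product $\cdot$ such that $(x\cdot y)\cdot z-x\cdot(y\cdot z)=(y\cdot x)\cdot z-y\cdot(x\cdot z)$ for all $x,y,z$. A left-symmetric algebroid $(A,\cdot_A,a_A)$ is a vector bundle $A\to M$ with an ($\mathbb{R}$-bilinear) left-symmetric algebra structure $\cdot_A$ on $\Gamma(A)$ and a bundle map $a_A:A\to TM$ (the anchor) such that for all $f\in C^\infty(M)$, $x,y\in\Gamma(A)$: $x\cdot_A(fy)=f(x\cdot_A y)+a_A(x)(f)y$ and $(fx)\cdot_A y=f(x\cdot_A y)$. A Lie algebroid $(A,[\cdot,\cdot]_A,a_A)$ is a vector bundle $A\to M$ with a Lie algebra structure on $\Gamma(A)$ and a bundle map $a_A:A\to TM$ such that $[x,fy]_A=f[x,y]_A+a_A(x)(f)y$. For a vector bundle $E$, $\mathfrak{D}(E)$ is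 the Lie algebroid of covariant differential operators of $E$: its sections are the $\mathbb{R}$-linear maps $\mathfrak d:\Gamma(E)\to\Gamma(E)$ for which there is a vector field $X$ (the anchor of $\mathfrak d$) with $\mathfrak d(fu)=f\mathfrak d(u)+X(f)u$; the bracket is the commutator. A representation of a Lie algebroid $A$ on $E$ is a bundle map $\rho:A\to\mathfrak{D}(E)$ compatible with anchors (the anchor of $\rho(x)$ is $a_A(x)$) and with brackets ($\rho([x,y]_A)=[\rho(x),\rho(y)]$). *)

(* Defs.v *)
From HB Require Import structures.
From mathcomp Require Import all_boot all_order all_algebra.
From mathcomp Require Import all_classical all_reals all_analysis.
From mathcomp Require Import ring.
Set Implicit Arguments.
Unset Strict Implicit.
Unset Printing Implicit Defensive.
Import Order.TTheory GRing.Theory Num.Theory.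
Import numFieldNormedType.Exports.
Local Open Scope classical_set_scope.
Local Open Scope ring_scope.

Section SmoothEuclidean.
Variables (R : realType) (n : nat).
Implicit Types (U V : set 'rV[R]_n) (f g : 'rV[R]_n -> R) (k : nat).

(* Only meant for [U] open, where continuity and partial derivatives at a
   point of [U] do not see the values of [f] outside [U]. *)
Fixpoint Ck k U f : Prop :=
  (forall x, U x -> {for x, continuous f}) /\
  if k is k'.+1 then
    forall i, (forall x, U x -> derivable f x (delta_mx 0 i)) /\
              Ck k' U (fun x => 'D_(delta_mx 0 i) f x)
  else True.

Lemma Ck_sub k U V f : V `<=` U -> Ck k U f -> Ck k V f.
Proof.
move=> VU; elim: k f => [|k IH] f [cf df]; split=> //; try by move=> x /VU/cf.
by move=> i; have [d1 d2] := df i; split=> [x /VU/d1//|]; exact: IH.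
Qed.

Lemma Ck_eq k U f g : open U -> (forall x, U x -> f x = g x) ->
  Ck k U f -> Ck k U g.
Proof.
move=> oU.
have e f1 g1 x : (forall x, U x -> f1 x = g1 x) -> U x ->
    {near nbhs x, f1 =1 g1}.
  move=> fg Ux; near=> y; apply: fg; near: y.
  by apply: open_nbhs_nbhs.
have c f1 g1 : (forall x, U x -> f1 x = g1 x) ->
    (forall x, U x -> {for x, continuous f1}) ->
    forall x, U x -> {for x, continuous g1}.
  move=> fg cf x Ux.
  have : f1 y @[y --> x] --> f1 x := cf x Ux.
  rewrite (fg x Ux); apply: cvg_trans.
  exact: (@near_eq_cvg _ _ (nbhs x) (nbhs_filter x) f1 g1 (e _ _ _ fg Ux)).
elim: k f g => [|k IH] f g fg [cf df]; split=> //; try exact: c fg cf.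
move=> i; have [d1 d2] := df i; split=> [x Ux|].
  by have := d1 _ Ux; apply: near_eq_derivable; exact: e.
by apply: IH d2 => x Ux; apply: near_eq_derive; exact: e.
Unshelve. all: by end_near. Qed.

Lemma Ck_W k U f : Ck k.+1 U f -> Ck k U f.
Proof.
elim: k f => [|k IH] f [cf df]; split=> // i.
by have [d1 d2] := df i; split=> //; exact: IH.
Qed.

Lemma Ck_cst k U (c : R) : open U -> Ck k U (fun=> c).
Proof.
move=> oU; have cc c' : forall x, U x -> {for x, continuous (fun=> c' : R)}.
  by move=> x _; exact: cst_continuous.
elim: k c => [|k IH] c; first by split; [exact: cc|].
split=> [|i]; first exact: cc.
split=> [x _|]; first exact: (derivable_cst c x).
by apply: (Ck_eq oU _ (IH 0)) => x _; rewrite (derive_cst c).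
Qed.

Lemma Ck_add k U f g : open U -> Ck k U f -> Ck k U g ->
  Ck k U (fun x => f x + g x).
Proof.
move=> oU; elim: k f g => [|k IH] f g [cf df] [cg dg]; split=> //;
  try by move=> x Ux; exact: (continuousD (cf x Ux) (cg x Ux)).
move=> i; have [df1 df2] := df i; have [dg1 dg2] := dg i; split=> [x Ux|].
  exact: (derivableD (df1 _ Ux) (dg1 _ Ux)).
apply: (Ck_eq oU _ (IH _ _ df2 dg2)) => x Ux.
by rewrite [RHS](deriveD (df1 _ Ux) (dg1 _ Ux)).
Qed.

Lemma Ck_mul k U f g : open U -> Ck k U f -> Ck k U g ->
  Ck k U (fun x => f x * g x).
Proof.
move=> oU; elim: k f g => [|k IH] f g Hf Hg.
  by move: Hf Hg => [cf df] [cg dg]; split=> // x Ux;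
    exact: (continuousM (cf x Ux) (cg x Ux)).
have := (Ck_W Hf, Ck_W Hg) => -[Wf Wg].
move: Hf Hg => [cf df] [cg dg]; split=> [x Ux|i].
  exact: (continuousM (cf x Ux) (cg x Ux)).
have [df1 df2] := df i; have [dg1 dg2] := dg i; split=> [x Ux|].
  exact: (derivableM (df1 _ Ux) (dg1 _ Ux)).
apply: (Ck_eq oU _ (Ck_add oU (IH _ _ Wf dg2) (IH _ _ Wg df2))) => x Ux.
by rewrite [RHS](deriveM (df1 _ Ux) (dg1 _ Ux)).
Qed.

End SmoothEuclidean.

(* A chart: a homeomorphism [cfun] from an open set [cdom] of [M] onto an open
   set [ccod] of R^n, with inverse [cinv]; both maps are extended arbitrarily
   outside these sets. *)
Record chart (R : realType) (n : nat) (M : topologicalType) := Chart {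
  cdom : set M;
  ccod : set 'rV[R]_n;
  cfun : M -> 'rV[R]_n;
  cinv : 'rV[R]_n -> M;
  cdom_open : open cdom;
  ccod_open : open ccod;
  cfun_cod : forall p, cdom p -> ccod (cfun p);
  cinv_dom : forall x, ccod x -> cdom (cinv x);
  cfunK : forall p, cdom p -> cinv (cfun p) = p;
  cinvK : forall x, ccod x -> cfun (cinv x) = x;
  cfun_continuous : forall p, cdom p -> {for p, continuous cfun};
  cinv_continuous : forall x, ccod x -> {for x, continuous cinv} }.

Record manifold (R : realType) (n : nat) := Manifold {
  carrier :> topologicalType;
  manifold_hausdorff : hausdorff_space carrier;
  manifold_second_countable : @second_countable carrier;
  atlas_index : Type;
  atlas : atlas_index -> chart R n carrier;
  atlas_cover : forall p, exists i, cdom (atlas i) p;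
  atlas_compat : forall i j (l : 'I_n) k,
    Ck k (ccod (atlas i) `&` cinv (atlas i) @^-1` cdom (atlas j))
         (fun x => cfun (atlas j) (cinv (atlas i) x) 0 l) }.

Section SmoothFunctions.
Variables (R : realType) (n : nat) (M : manifold R n).
Implicit Types (W : set M) (f g : M -> R).

Definition smooth_on W f : Prop := forall (i : atlas_index M) k,
  Ck k (ccod (atlas i) `&` cinv (atlas i) @^-1` W) (f \o cinv (atlas i)).

Lemma chart_preim_open W (i : atlas_index M) : open W ->
  open (ccod (atlas i) `&` cinv (atlas i) @^-1` W).
Proof.
move=> oW; rewrite openE => x [cx Wx]; apply: filterI.
  by apply: open_nbhs_nbhs; split=> //; exact: ccod_open.
by apply: (cinv_continuous cx); exact: open_nbhs_nbhs.
Qed.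

Lemma smooth_on_sub W W' f : W' `<=` W -> smooth_on W f -> smooth_on W' f.
Proof. by move=> s Hf i k; apply: Ck_sub (Hf i k) => x [? /s]. Qed.

Lemma smooth_on_eq W f g : open W -> (forall p, W p -> f p = g p) ->
  smooth_on W f -> smooth_on W g.
Proof.
move=> oW fg Hf i k.
by apply: (Ck_eq (chart_preim_open (i := i) oW) _ (Hf i k)) => x [_ /fg].
Qed.

Lemma smooth_on_cst W (c : R) : open W -> smooth_on W (fun=> c).
Proof. by move=> oW i k; apply: Ck_cst; exact: chart_preim_open. Qed.

Lemma smooth_onD W f g : open W -> smooth_on W f -> smooth_on W g ->
  smooth_on W (fun p => f p + g p).
Proof. by move=> oW Hf Hg i k; apply: Ck_add => //; exact: chart_preim_open. Qed.

Lemma smooth_onM W f g : open W -> smooth_on W f -> smooth_on W g ->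
  smooth_on W (fun p => f p * g p).
Proof. by move=> oW Hf Hg i k; apply: Ck_mul => //; exact: chart_preim_open. Qed.

Lemma smooth_onN W f : open W -> smooth_on W f -> smooth_on W (fun p => - f p).
Proof.
move=> oW Hf; apply: (smooth_on_eq oW _ (smooth_onM oW (smooth_on_cst (-1) oW) Hf)).
by move=> p _; rewrite mulN1r.
Qed.

Record smooth := Smooth {
  smooth_fun :> M -> R;
  smoothP : smooth_on setT smooth_fun }.

Lemma smooth_ext (f g : smooth) : (forall p, f p = g p) -> f = g.
Proof.
case: f g => [f Hf] [g Hg] /= /funext e; subst g.
by congr Smooth; exact: Prop_irrelevance.
Qed.

HB.instance Definition _ := gen_eqMixin smooth.
HB.instance Definition _ := gen_choiceMixin smooth.

Definition smooth_cst (c : R) := Smooth (smooth_on_cst c openT).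
Definition smooth_add (f g : smooth) :=
  Smooth (smooth_onD openT (smoothP f) (smoothP g)).
Definition smooth_opp (f : smooth) := Smooth (smooth_onN openT (smoothP f)).
Definition smooth_mul (f g : smooth) :=
  Smooth (smooth_onM openT (smoothP f) (smoothP g)).

Fact smooth_addA : associative smooth_add.
Proof. by move=> f g h; apply: smooth_ext => p /=; rewrite addrA. Qed.
Fact smooth_addC : commutative smooth_add.
Proof. by move=> f g; apply: smooth_ext => p /=; rewrite addrC. Qed.
Fact smooth_add0 : left_id (smooth_cst 0) smooth_add.
Proof. by move=> f; apply: smooth_ext => p /=; rewrite add0r. Qed.
Fact smooth_addN : left_inverse (smooth_cst 0) smooth_opp smooth_add.
Proof. by move=> f; apply: smooth_ext => p /=; rewrite addNr. Qed.
HB.instance Definition _ := GRing.isZmodule.Build smooth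
  smooth_addA smooth_addC smooth_add0 smooth_addN.

Fact smooth_mulA : associative smooth_mul.
Proof. by move=> f g h; apply: smooth_ext => p /=; rewrite mulrA. Qed.
Fact smooth_mulC : commutative smooth_mul.
Proof. by move=> f g; apply: smooth_ext => p /=; rewrite mulrC. Qed.
Fact smooth_mul1 : left_id (smooth_cst 1) smooth_mul.
Proof. by move=> f; apply: smooth_ext => p /=; rewrite mul1r. Qed.
Fact smooth_mulD : left_distributive smooth_mul smooth_add.
Proof. by move=> f g h; apply: smooth_ext => p /=; rewrite mulrDl. Qed.
HB.instance Definition _ := GRing.Zmodule_isComPzRing.Build smooth
  smooth_mulA smooth_mulC smooth_mul1 smooth_mulD.

Definition smooth_scale (c : R) (f : smooth) : smooth := smooth_cst c * f.
Fact smooth_scaleA (a b : R) (f : smooth) :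
  smooth_scale a (smooth_scale b f) = smooth_scale (a * b) f.
Proof. by apply: smooth_ext => p /=; rewrite mulrA. Qed.
Fact smooth_scale1 : left_id 1 smooth_scale.
Proof. by move=> f; apply: smooth_ext => p /=; rewrite mul1r. Qed.
Fact smooth_scaleDr : right_distributive smooth_scale +%R.
Proof. by move=> a f g; apply: smooth_ext => p /=; rewrite mulrDr. Qed.
Fact smooth_scaleDl (f : smooth) : {morph smooth_scale^~ f : a b / a + b}.
Proof. by move=> a b; apply: smooth_ext => p /=; rewrite mulrDl. Qed.
HB.instance Definition _ := GRing.Zmodule_isLmodule.Build R smooth
  smooth_scaleA smooth_scale1 smooth_scaleDr smooth_scaleDl.

End SmoothFunctions.

Section VectorFields.
Variables (R : realType) (n : nat) (M : manifold R n).
Notation C := (smooth M).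

(* T_p M, as the space of derivations of C^oo(M) at p. *)
Record tangent (p : M) := Tangent {
  tangent_fun :> C -> R;
  tangent_scalar : scalar tangent_fun;
  tangent_leibniz : forall f g : C,
    tangent_fun (f * g) = f p * tangent_fun g + g p * tangent_fun f }.

Lemma tangent_ext p (v w : tangent p) : (forall f, v f = w f) -> v = w.
Proof.
case: v w => [v v1 v2] [w w1 w2] /= /funext e; subst w.
by congr Tangent; exact: Prop_irrelevance.
Qed.

HB.instance Definition _ p := gen_eqMixin (tangent p).
HB.instance Definition _ p := gen_choiceMixin (tangent p).

Section TangentSpace.
Variable p : M.
Implicit Types v w : tangent p.

Fact tangent_comb_scalar (a : R) v w : scalar (fun f => a * v f + w f).
Proof.
move=> c f g; rewrite !tangent_scalar /= !mulrDr addrACA; congr (_ + _).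
by rewrite !mulrA (mulrC a).
Qed.
Fact tangent_comb_leibniz (a : R) v w (f g : C) :
  a * v (f * g) + w (f * g) = f p * (a * v g + w g) + g p * (a * v f + w f).
Proof.
rewrite !tangent_leibniz !mulrDr -!addrA; congr (_ + _); first by rewrite mulrCA.
by rewrite addrCA; congr (_ + _); rewrite mulrCA.
Qed.
Definition tangent_comb (a : R) v w : tangent p :=
  Tangent (tangent_comb_scalar a v w) (tangent_comb_leibniz a v w).

Fact tangent_zero_scalar : scalar (fun _ : C => 0 : R).
Proof. by move=> c f g; rewrite /= mulr0 addr0. Qed.
Fact tangent_zero_leibniz (f g : C) : (0 : R) = f p * 0 + g p * 0.
Proof. by rewrite !mulr0 addr0. Qed.
Definition tangent_zero : tangent p :=
  Tangent tangent_zero_scalar tangent_zero_leibniz.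

Definition tangent_scale (a : R) v := tangent_comb a v tangent_zero.
Definition tangent_add v w := tangent_comb 1 v w.
Definition tangent_opp v := tangent_scale (-1) v.

Fact tangent_addA : associative tangent_add.
Proof. by move=> u v w; apply: tangent_ext => f /=; rewrite !mul1r addrA. Qed.
Fact tangent_addC : commutative tangent_add.
Proof. by move=> u v; apply: tangent_ext => f /=; rewrite !mul1r addrC. Qed.
Fact tangent_add0 : left_id tangent_zero tangent_add.
Proof. by move=> u; apply: tangent_ext => f /=; rewrite mulr0 add0r. Qed.
Fact tangent_addN : left_inverse tangent_zero tangent_opp tangent_add.
Proof.
by move=> u; apply: tangent_ext => f /=; rewrite mul1r addr0 mulN1r addNr.
Qed.
HB.instance Definition _ := GRing.isZmodule.Build (tangent p)
  tangent_addA tangent_addC tangent_add0 tangent_addN.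

Fact tangent_scaleA (a b : R) v :
  tangent_scale a (tangent_scale b v) = tangent_scale (a * b) v.
Proof. by apply: tangent_ext => f /=; rewrite !addr0 mulrA. Qed.
Fact tangent_scale1 : left_id 1 tangent_scale.
Proof. by move=> v; apply: tangent_ext => f /=; rewrite mul1r addr0. Qed.
Fact tangent_scaleDr : right_distributive tangent_scale +%R.
Proof.
by move=> a v w; apply: tangent_ext => f /=; rewrite !addr0 !mul1r mulrDr.
Qed.
Fact tangent_scaleDl v : {morph tangent_scale^~ v : a b / a + b}.
Proof.
by move=> a b; apply: tangent_ext => f /=; rewrite !addr0 mul1r mulrDl.
Qed.
HB.instance Definition _ := GRing.Zmodule_isLmodule.Build R (tangent p)
  tangent_scaleA tangent_scale1 tangent_scaleDr tangent_scaleDl.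

End TangentSpace.

Lemma tangentDE p (v w : tangent p) f : (v + w) f = v f + w f.
Proof. by rewrite /= mul1r. Qed.
Lemma tangentNE p (v : tangent p) f : (- v) f = - v f.
Proof. by rewrite /= addr0 mulN1r. Qed.
Lemma tangentZE p a (v : tangent p) f : (a *: v) f = a * v f.
Proof. by rewrite /= addr0. Qed.

(* Smooth sections of TM: smoothness of X is tested on the functions X(f). *)
Record vfield := VField {
  vfield_at :> forall p, tangent p;
  vfieldP : forall f : C, smooth_on setT (fun p => vfield_at p f) }.

(* The function X(f). *)
Definition vact (X : vfield) (f : C) : C := Smooth (vfieldP X f).

Lemma vfield_ext (X Y : vfield) : (forall p, X p = Y p) -> X = Y.
Proof.
case: X Y => [X HX] [Y HY] /= e.
have {e} e : X = Y by exact: functional_extensionality_dep.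
subst Y.
by congr VField; exact: Prop_irrelevance.
Qed.

HB.instance Definition _ := gen_eqMixin vfield.
HB.instance Definition _ := gen_choiceMixin vfield.

Fact vfield_zeroP f : smooth_on setT (fun p => (0 : tangent p) f).
Proof. exact: smoothP (0 : C). Qed.
Definition vfield_zero := @VField (fun p => 0) vfield_zeroP.

Fact vfield_addP (X Y : vfield) f : smooth_on setT (fun p => (X p + Y p) f).
Proof.
apply: (smooth_on_eq openT _ (smoothP (vact X f + vact Y f))) => p _.
by rewrite tangentDE.
Qed.
Definition vfield_add (X Y : vfield) := @VField (fun p => X p + Y p) (vfield_addP X Y).

Fact vfield_oppP (X : vfield) f : smooth_on setT (fun p => (- X p) f).
Proof.
apply: (smooth_on_eq openT _ (smoothP (- vact X f))) => p _.
by rewrite tangentNE.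
Qed.
Definition vfield_opp (X : vfield) := @VField (fun p => - X p) (vfield_oppP X).

Fact vfield_scaleP (f : C) (X : vfield) g :
  smooth_on setT (fun p => (f p *: X p) g).
Proof.
apply: (smooth_on_eq openT _ (smoothP (f * vact X g))) => p _.
by rewrite tangentZE.
Qed.
Definition vfield_scale (f : C) (X : vfield) :=
  @VField (fun p => f p *: X p) (vfield_scaleP f X).

Fact vfield_addA : associative vfield_add.
Proof. by move=> X Y Z; apply: vfield_ext => p; exact: addrA. Qed.
Fact vfield_addC : commutative vfield_add.
Proof. by move=> X Y; apply: vfield_ext => p; exact: addrC. Qed.
Fact vfield_add0 : left_id vfield_zero vfield_add.
Proof. by move=> X; apply: vfield_ext => p; exact: add0r. Qed.
Fact vfield_addN : left_inverse vfield_zero vfield_opp vfield_add.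
Proof. by move=> X; apply: vfield_ext => p; exact: addNr. Qed.
HB.instance Definition _ := GRing.isZmodule.Build vfield
  vfield_addA vfield_addC vfield_add0 vfield_addN.

Fact vfield_scaleA (f g : C) X :
  vfield_scale f (vfield_scale g X) = vfield_scale (f * g) X.
Proof. by apply: vfield_ext => p; exact: scalerA. Qed.
Fact vfield_scale1 : left_id 1 vfield_scale.
Proof. by move=> X; apply: vfield_ext => p; exact: scale1r. Qed.
Fact vfield_scaleDr : right_distributive vfield_scale +%R.
Proof. by move=> f X Y; apply: vfield_ext => p; exact: scalerDr. Qed.
Fact vfield_scaleDl X : {morph vfield_scale^~ X : f g / f + g}.
Proof. by move=> f g; apply: vfield_ext => p; exact: scalerDl. Qed.
HB.instance Definition _ := GRing.Zmodule_isLmodule.Build C vfield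
  vfield_scaleA vfield_scale1 vfield_scaleDr vfield_scaleDl.

Lemma vact0 f : vact 0 f = 0.
Proof. exact: smooth_ext. Qed.
Lemma vactD X Y f : vact (X + Y) f = vact X f + vact Y f.
Proof. by apply: smooth_ext => p /=; rewrite mul1r. Qed.
Lemma vactN X f : vact (- X) f = - vact X f.
Proof. by apply: smooth_ext => p /=; rewrite addr0 mulN1r. Qed.
Lemma vactZ g X f : vact (g *: X) f = g * vact X f.
Proof. by apply: smooth_ext => p /=; rewrite addr0. Qed.

Lemma vact_linear X : linear (vact X).
Proof. by move=> c f g; apply: smooth_ext => p /=; rewrite tangent_scalar. Qed.
Lemma vactM X f g : vact X (f * g) = f * vact X g + g * vact X f.
Proof. by apply: smooth_ext => p /=; rewrite tangent_leibniz. Qed.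

Fact vfield_bracket_scalar (X Y : vfield) p :
  scalar (fun f => X p (vact Y f) - Y p (vact X f)).
Proof.
move=> c f g; rewrite !vact_linear !tangent_scalar /=.
by rewrite opprD addrACA -mulrBr.
Qed.
Fact vfield_bracket_leibniz (X Y : vfield) p (f g : C) :
  X p (vact Y (f * g)) - Y p (vact X (f * g)) =
  f p * (X p (vact Y g) - Y p (vact X g)) + g p * (X p (vact Y f) - Y p (vact X f)).
Proof.
have tD (v : tangent p) h k : v (h + k) = v h + v k.
  by rewrite -[h]scale1r tangent_scalar /= scale1r mul1r.
rewrite !vactM !tD !tangent_leibniz /= !mulrBr.
ring.
Qed.
Fact vfield_bracketP (X Y : vfield) f : smooth_on setT (fun p =>
  Tangent (vfield_bracket_scalar X Y p) (vfield_bracket_leibniz X Y p) f).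
Proof. exact: smoothP (vact X (vact Y f) - vact Y (vact X f)). Qed.
Definition vfield_bracket (X Y : vfield) : vfield := VField (vfield_bracketP X Y).

Lemma vact_bracket X Y f :
  vact (vfield_bracket X Y) f = vact X (vact Y f) - vact Y (vact X f).
Proof. exact: smooth_ext. Qed.

End VectorFields.

(* A smooth vector bundle of rank [r]: a family of real vector spaces with
   local trivializations [triv i p : E_p -> R^r] over open sets [tdom i], with
   inverse [trivV i p] for [p] in [tdom i], the entries of the transition
   matrices being smooth. *)
Record vbundle (R : realType) (n : nat) (M : manifold R n) (r : nat) := VBundle {
  fib : M -> lmodType R;
  triv_index : Type;
  tdom : triv_index -> set M;
  triv : forall (i : triv_index) (p : M), {linear fib p -> 'rV[R]_r};
  trivV : forall (i : triv_index) (p : M), 'rV[R]_r -> fib p;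
  tdom_open : forall i, open (tdom i);
  tdom_cover : forall p, exists i, tdom i p;
  trivK : forall i p, tdom i p -> cancel (triv i p) (trivV i p);
  trivVK : forall i p, tdom i p -> cancel (trivV i p) (triv i p);
  triv_compat : forall i j (k l : 'I_r),
    smooth_on (tdom i `&` tdom j)
      (fun p => triv j p (trivV i p (delta_mx 0 k)) 0 l) }.

Section Sections.
Variables (R : realType) (n : nat) (M : manifold R n) (r : nat).
Variable E : vbundle M r.
Notation C := (smooth M).

Record section := MkSection {
  section_at :> forall p, fib E p;
  sectionP : forall (i : triv_index E) (k : 'I_r),
    smooth_on (tdom i) (fun p => triv i p (section_at p) 0 k) }.

Lemma section_ext (u v : section) : (forall p, u p = v p) -> u = v.
Proof.
case: u v => [u Hu] [v Hv] /= e.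
have {e} e : u = v by exact: functional_extensionality_dep.
subst v.
by congr MkSection; exact: Prop_irrelevance.
Qed.

HB.instance Definition _ := gen_eqMixin section.
HB.instance Definition _ := gen_choiceMixin section.

Fact section_zeroP i k : smooth_on (tdom i) (fun p => triv (v:=E) i p 0 0 k).
Proof.
apply: (smooth_on_eq (tdom_open i) _ (smooth_on_cst 0 (tdom_open i))).
by move=> p _; rewrite linear0 mxE.
Qed.
Definition section_zero := MkSection section_zeroP.

Fact section_addP (u v : section) i k :
  smooth_on (tdom i) (fun p => triv i p (u p + v p) 0 k).
Proof.
have oT := tdom_open i.
apply: (smooth_on_eq oT _ (smooth_onD oT (sectionP u i k) (sectionP v i k))).
by move=> p _; rewrite linearD mxE.
Qed.
Definition section_add (u v : section) := MkSection (section_addP u v).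

Fact section_oppP (u : section) i k :
  smooth_on (tdom i) (fun p => triv i p (- u p) 0 k).
Proof.
have oT := tdom_open i.
apply: (smooth_on_eq oT _ (smooth_onN oT (sectionP u i k))).
by move=> p _; rewrite linearN mxE.
Qed.
Definition section_opp (u : section) := MkSection (section_oppP u).

Fact section_scaleP (f : C) (u : section) i k :
  smooth_on (tdom i) (fun p => triv i p (f p *: u p) 0 k).
Proof.
have oT := tdom_open i.
have Hf : smooth_on (tdom i) f by apply: smooth_on_sub (smoothP f).
apply: (smooth_on_eq oT _ (smooth_onM oT Hf (sectionP u i k))).
by move=> p _; rewrite linearZ mxE.
Qed.
Definition section_scale (f : C) (u : section) := MkSection (section_scaleP f u).

Fact section_addA : associative section_add.
Proof. by move=> u v w; apply: section_ext => p; exact: addrA. Qed.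
Fact section_addC : commutative section_add.
Proof. by move=> u v; apply: section_ext => p; exact: addrC. Qed.
Fact section_add0 : left_id section_zero section_add.
Proof. by move=> u; apply: section_ext => p; exact: add0r. Qed.
Fact section_addN : left_inverse section_zero section_opp section_add.
Proof. by move=> u; apply: section_ext => p; exact: addNr. Qed.
HB.instance Definition _ := GRing.isZmodule.Build section
  section_addA section_addC section_add0 section_addN.

Fact section_scaleA (f g : C) u :
  section_scale f (section_scale g u) = section_scale (f * g) u.
Proof. by apply: section_ext => p; exact: scalerA. Qed.
Fact section_scale1 : left_id 1 section_scale.
Proof. by move=> u; apply: section_ext => p; exact: scale1r. Qed.
Fact section_scaleDr : right_distributive section_scale +%R.
Proof. by move=> f u v; apply: section_ext => p; exact: scalerDr. Qed.
Fact section_scaleDl u : {morph section_scale^~ u : f g / f + g}.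
Proof. by move=> f g; apply: section_ext => p; exact: scalerDl. Qed.
HB.instance Definition _ := GRing.Zmodule_isLmodule.Build C section
  section_scaleA section_scale1 section_scaleDr section_scaleDl.

(* The canonical scalars of [section] are the smooth functions; [rsection] is
   the same type with the underlying structure of real vector space. *)
Definition rsection : Type := section.
HB.instance Definition _ := GRing.Zmodule.on rsection.

Definition rsection_scale (c : R) (u : rsection) : rsection :=
  (smooth_cst M c *: (u : section) : section).
Fact rsection_scaleA (a b : R) u :
  rsection_scale a (rsection_scale b u) = rsection_scale (a * b) u.
Proof. by apply: section_ext => p; exact: scalerA. Qed.
Fact rsection_scale1 : left_id 1 rsection_scale.
Proof. by move=> u; apply: section_ext => p; exact: scale1r. Qed.
Fact rsection_scaleDr : right_distributive rsection_scale +%R.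
Proof. by move=> a u v; apply: section_ext => p; exact: scalerDr. Qed.
Fact rsection_scaleDl u : {morph rsection_scale^~ u : a b / a + b}.
Proof. by move=> a b; apply: section_ext => p; exact: scalerDl. Qed.
HB.instance Definition _ := GRing.Zmodule_isLmodule.Build R rsection
  rsection_scaleA rsection_scale1 rsection_scaleDr rsection_scaleDl.

(* [X] is an anchor of [d]; it is unique unless [E] has rank 0. *)
Definition has_anchor (d : section -> section) (X : vfield M) : Prop :=
  forall (f : C) (u : section), d (f *: u) = f *: d u + vact X f *: u.

(* Sections of the bundle D(E) of covariant differential operators; their
   C^oo(M)-module structure and commutator bracket are defined below. *)
Record cdo := Cdo {
  cdo_fun :> section -> section;
  cdo_linear : linear (cdo_fun : rsection -> rsection);
  cdo_anchored : exists X : vfield M, has_anchor cdo_fun X }.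

Lemma cdo_ext (d e : cdo) : (forall u, d u = e u) -> d = e.
Proof.
case: d e => [d d1 d2] [e e1 e2] /= /funext de; subst e.
by congr Cdo; exact: Prop_irrelevance.
Qed.

HB.instance Definition _ := gen_eqMixin cdo.
HB.instance Definition _ := gen_choiceMixin cdo.

Fact cdo_zero_linear : linear ((fun=> 0) : rsection -> rsection).
Proof. by move=> c u v; rewrite scaler0 addr0. Qed.
Fact cdo_zero_anchored : exists X, has_anchor (fun=> 0) X.
Proof.
by exists 0 => f u; rewrite vact0 scaler0 scale0r addr0.
Qed.
Definition cdo_zero := Cdo cdo_zero_linear cdo_zero_anchored.

Fact cdo_add_linear (d e : cdo) :
  linear ((fun u => d u + e u) : rsection -> rsection).
Proof.
move=> c u v; have := cdo_linear d c u v; have := cdo_linear e c u v.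
by move=> /= -> ->; rewrite scalerDr addrACA.
Qed.
Lemma has_anchorD d e X Y : has_anchor d X -> has_anchor e Y ->
  has_anchor (fun u => d u + e u) (X + Y).
Proof.
by move=> dX eY f u; rewrite dX eY vactD scalerDr scalerDl addrACA.
Qed.
Fact cdo_add_anchored (d e : cdo) : exists X, has_anchor (fun u => d u + e u) X.
Proof.
have [X dX] := cdo_anchored d; have [Y eY] := cdo_anchored e.
by exists (X + Y); exact: has_anchorD.
Qed.
Definition cdo_add (d e : cdo) := Cdo (cdo_add_linear d e) (cdo_add_anchored d e).

Fact cdo_scale_linear (g : C) (d : cdo) :
  linear ((fun u => g *: d u) : rsection -> rsection).
Proof.
move=> c u v; have /= -> := cdo_linear d c u v; rewrite scalerDr.
congr (_ + _); rewrite /GRing.scale /= /rsection_scale.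
by apply: section_ext => p /=; rewrite !scalerA mulrC.
Qed.
Lemma has_anchorZ g d X : has_anchor d X -> has_anchor (fun u => g *: d u) (g *: X).
Proof.
by move=> dX f u; rewrite dX vactZ scalerDr !scalerA (mulrC g f).
Qed.
Fact cdo_scale_anchored (g : C) (d : cdo) :
  exists X, has_anchor (fun u => g *: d u) X.
Proof. by have [X dX] := cdo_anchored d; exists (g *: X); exact: has_anchorZ. Qed.
Definition cdo_scale (g : C) (d : cdo) :=
  Cdo (cdo_scale_linear g d) (cdo_scale_anchored g d).

Fact cdo_addA : associative cdo_add.
Proof. by move=> c d e; apply: cdo_ext => u; exact: addrA. Qed.
Fact cdo_addC : commutative cdo_add.
Proof. by move=> d e; apply: cdo_ext => u; exact: addrC. Qed.
Fact cdo_add0 : left_id cdo_zero cdo_add.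
Proof. by move=> d; apply: cdo_ext => u; exact: add0r. Qed.
Fact cdo_addN : left_inverse cdo_zero (cdo_scale (-1)) cdo_add.
Proof. by move=> d; apply: cdo_ext => u /=; rewrite scaleN1r addNr. Qed.
HB.instance Definition _ := GRing.isZmodule.Build cdo
  cdo_addA cdo_addC cdo_add0 cdo_addN.

Fact cdo_scaleA (f g : C) d : cdo_scale f (cdo_scale g d) = cdo_scale (f * g) d.
Proof. by apply: cdo_ext => u; exact: scalerA. Qed.
Fact cdo_scale1 : left_id 1 cdo_scale.
Proof. by move=> d; apply: cdo_ext => u; exact: scale1r. Qed.
Fact cdo_scaleDr : right_distributive cdo_scale +%R.
Proof. by move=> f d e; apply: cdo_ext => u; exact: scalerDr. Qed.
Fact cdo_scaleDl d : {morph cdo_scale^~ d : f g / f + g}.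
Proof. by move=> f g; apply: cdo_ext => u; exact: scalerDl. Qed.
HB.instance Definition _ := GRing.Zmodule_isLmodule.Build C cdo
  cdo_scaleA cdo_scale1 cdo_scaleDr cdo_scaleDl.

Lemma cdoD (d : cdo) u v : d (u + v) = d u + d v.
Proof. by have := cdo_linear d 1 u v; rewrite !scale1r. Qed.
Fact cdo_bracket_linear (d e : cdo) :
  linear ((fun u => d (e u) - e (d u)) : rsection -> rsection).
Proof.
move=> c u v; have /= -> := cdo_linear e c u v; have /= -> := cdo_linear d c u v.
have /= -> := cdo_linear e c (d u) (d v).
have /= -> := cdo_linear d c (e u) (e v).
by rewrite opprD addrACA -scalerBr.
Qed.
Fact cdo_bracket_anchored (d e : cdo) :
  exists X, has_anchor (fun u => d (e u) - e (d u)) X.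
Proof.
have [X dX] := cdo_anchored d; have [Y eY] := cdo_anchored e.
exists (vfield_bracket X Y) => f u.
rewrite eY dX !cdoD !dX !eY vact_bracket scalerBl scalerBr !opprD.
set a := f *: d (e u); set b := vact X f *: e u; set c := vact Y f *: d u.
set a' := f *: e (d u); set b' := vact X _ *: u; set c' := vact Y _ *: u.
rewrite [c + b']addrC (addrACA a b) [- b - c']addrC (addrACA (- a')) -(opprD c b).
rewrite (addrC c b) (addrACA (a + b')) subrr addr0; exact: addrACA.
Qed.
Definition cdo_bracket (d e : cdo) :=
  Cdo (cdo_bracket_linear d e) (cdo_bracket_anchored d e).

End Sections.

Section Algebras.
Variables (K : fieldType) (V : lmodType K).

Record is_left_symmetric_algebra (mul : V -> V -> V) : Prop := {
  lsa_linearl : forall y, linear (mul^~ y);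
  lsa_linearr : forall x, linear (mul x);
  lsa_sym : forall x y z,
    mul (mul x y) z - mul x (mul y z) = mul (mul y x) z - mul y (mul x z) }.

Record is_lie_algebra (br : V -> V -> V) : Prop := {
  lie_linearl : forall y, linear (br^~ y);
  lie_linearr : forall x, linear (br x);
  lie_alternating : forall x, br x x = 0;
  lie_jacobi : forall x y z,
    br x (br y z) + br y (br z x) + br z (br x y) = 0 }.

End Algebras.

(* A bundle map over the identity is given by the C^oo(M)-linear map it induces
   on sections; in particular an anchor A -> TM is a map
   {linear section A -> vfield M}, and a bundle map A -> D(E) is a map
   {linear section A -> cdo E}. *)
Section Algebroids.
Variables (R : realType) (n : nat) (M : manifold R n) (r : nat).
Variable A : vbundle M r.

Record is_left_symmetric_algebroid (mul : section A -> section A -> section A)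
    (a : {linear section A -> vfield M}) : Prop := {
  lsad_alg : is_left_symmetric_algebra (mul : rsection A -> rsection A -> rsection A);
  lsad_anchor : forall (f : smooth M) (x y : section A),
    mul x (f *: y) = f *: mul x y + vact (a x) f *: y;
  lsad_linear : forall (f : smooth M) (x y : section A),
    mul (f *: x) y = f *: mul x y }.

Record is_lie_algebroid (br : section A -> section A -> section A)
    (a : {linear section A -> vfield M}) : Prop := {
  liead_alg : is_lie_algebra (br : rsection A -> rsection A -> rsection A);
  liead_anchor : forall (f : smooth M) (x y : section A),
    br x (f *: y) = f *: br x y + vact (a x) f *: y }.

(* Compatibility of [rho] with anchors and brackets; that [(A, br, a)] is a Lie
   algebroid is not repeated here. *)
Record is_representation (br : section A -> section A -> section A)
    (a : {linear section A -> vfield M}) (s : nat) (E : vbundle M s)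
    (rho : {linear section A -> cdo E}) : Prop := {
  repr_anchor : forall x, has_anchor (rho x) (a x);
  repr_bracket : forall x y, rho (br x y) = cdo_bracket (rho x) (rho y) }.

End Algebroids.

(* Main.v *)
(** The left-symmetry of the associator says that [L_[x,y]] is the commutator
    of [L_x] and [L_y]; substituted in the Jacobi sum, it leaves twelve terms
    [u(vw)] that cancel in pairs.  The two Leibniz rules of [mul] give the
    Leibniz rule of the bracket and make each [L_x] a covariant differential
    operator with anchor [a x], depending linearly on [x]. *)
From HB Require Import structures.
Require Import Defs.
From mathcomp Require Import all_boot all_order all_algebra.
From mathcomp Require Import all_classical all_reals all_analysis.
Import GRing.Theory.
Local Open Scope ring_scope.

Section LeftSymmetricAlgebra.
Variables (K : fieldType) (V : lmodType K) (mul : V -> V -> V).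
Hypothesis mulP : is_left_symmetric_algebra mul.

Lemma lsa_mulBl x y z : mul (x - y) z = mul x z - mul y z.
Proof.
by have := lsa_linearl mulP z (-1) y x; rewrite /= !scaleN1r ![- _ + _]addrC.
Qed.

Lemma lsa_mulBr x y z : mul x (y - z) = mul x y - mul x z.
Proof.
by have := lsa_linearr mulP x (-1) z y; rewrite /= !scaleN1r ![- _ + _]addrC.
Qed.

(** Solving left-symmetry for [mul (mul x y) z] makes the terms [mul (mul y x) z] cancel. The
    identity serves twice: in the Jacobi sum and as bracket compatibility of [L]. *)
Lemma lsa_mul_commutator x y z :
  mul (mul x y - mul y x) z = mul x (mul y z) - mul y (mul x z).
Proof.
have /eqP := lsa_sym mulP x y z; rewrite subr_eq -addrA => /eqP e.
by rewrite lsa_mulBl e [X in X - _]addrC addrK addrC.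
Qed.

Lemma lsa_commutator_lie_algebra :
  is_lie_algebra (fun x y => mul x y - mul y x).
Proof.
have Ml := lsa_linearl mulP; have Mr := lsa_linearr mulP.
split=> [y c u v|x c u v|x|x y z] /=.
- by have /= -> := Ml y c u v; rewrite Mr scalerBr opprD addrACA.
- by have /= -> := Ml x c u v; rewrite Mr scalerBr opprD addrACA.
- exact: subrr.
(* [sumE] turns each double bracket into [P - N], with two products in each of [P] and [N]. Up to
   order, each [N] is the [P] of the cyclically next bracket, so the sum telescopes. *)
have sumE (t u v w : V) : t - u - (v - w) = (t + w) - (u + v).
  by rewrite opprB addrACA -opprD.
rewrite !lsa_mul_commutator !lsa_mulBr !sumE.
rewrite (addrC (mul x (mul z y))) subrKA.
by rewrite (addrC (mul y (mul x z))) subrKA (addrC (mul z _)) subrr.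
Qed.
End LeftSymmetricAlgebra.

Section LeftMultiplication.
Variables (R : realType) (n r : nat) (M : manifold R n) (A : vbundle M r).
Variables (mul : section A -> section A -> section A).
Variable a : {linear section A -> vfield M}.
Hypothesis mulP : is_left_symmetric_algebroid mul a.

Lemma lsad_has_anchor x : has_anchor (mul x) (a x).
Proof. by move=> f u; exact: lsad_anchor mulP f x u. Qed.

Definition lsad_left (x : section A) : cdo A :=
  Cdo (lsa_linearr (lsad_alg mulP) x) (ex_intro _ (a x) (lsad_has_anchor x)).

Lemma lsad_left_linear : linear lsad_left.
Proof.
move=> f x y; apply: cdo_ext => u /=; rewrite -(lsad_linear mulP).
(* Additivity is real linearity with scalar [1], applied to [f *: x] and [y]. *)
by have := lsa_linearl (lsad_alg mulP) u 1 (f *: x) y; rewrite /= !scale1r.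
Qed.

Lemma lsad_left_representation :
  exists L : {linear section A -> cdo A},
    (forall x y : section A, L x y = mul x y) /\
    is_representation (fun x y => mul x y - mul y x) a L.
Proof.
pose L : {linear section A -> cdo A} :=
  HB.pack lsad_left (GRing.isLinear.Build _ _ _ _ _ lsad_left_linear).
exists L; split=> //; split=> [|x y]; first exact: lsad_has_anchor.
(* Elements of [cdo A] with equal underlying maps are equal, the anchor being only asserted to
   exist. *)
by apply: cdo_ext => u; exact: lsa_mul_commutator (lsad_alg mulP) x y u.
Qed.

End LeftMultiplication.

Theorem theorem3p2 (R : realType) (n r : nat) (M : manifold R n)
    (A : vbundle M r)
    (mul : section A -> section A -> section A)
    (a : {linear section A -> vfield M}) :
  is_left_symmetric_algebroid mul a ->
  let br := fun x y : section A => mul x y - mul y x in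
  is_lie_algebroid br a /\
  exists L : {linear section A -> cdo A},
    (forall x y : section A, L x y = mul x y) /\
    is_representation br a L.
Proof.
move=> mulP br; split; last exact: lsad_left_representation.
split; first exact: lsa_commutator_lie_algebra (lsad_alg mulP).
(* Only [mul x (f *: y)] differentiates [f], so the bracket keeps the anchor [a]. *)
move=> f x y; rewrite /br (lsad_anchor mulP) (lsad_linear mulP).
by rewrite scalerBr addrAC.
Qed.
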